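(* Let $\{A_k\}_{k\ge 0}$ be i.i.d. complex valued random variables with $\mathbb{P}(A_0=0)<1$ and $\mathbb{E}[|A_0|^2]<\infty$, and let $P_n(z)=\sum_{k=0}^n A_k z^k$. Suppose that for some $\varepsilon>0$ the distribution of $|A_0|^2$ is absolutely continuous on $[0,\varepsilon]$ and its density is bounded on $[0,\varepsilon]$. Then for any $R>1$, $$\frac{1}{n}\frac{\|P_n'\|_{2,R}}{\|P_n\|_{2,R}}\longrightarrow\frac{1}{R}\quad\text{in probability as } n\to\infty.$$ As a consequence, $$\lim_{n\to\infty}\frac{1}{n}\,\mathbb{E}\left[\frac{\|P_n'\|_{2,R}}{\|P_n\|_{2,R}}\right]=\frac{1}{R},\quad R>1.$$
   Context: For a polynomial $P$ and $R>0$, $\|P\|_{2,R}=\left(\frac{1}{2\pi}\int_0^{2\pi}|P(Re^{it})|^2\,dt\right)^{1/2}$, and $P'$ is the derivative of $P$ in $z$. Convention: the ratio $\|P'\|_{2,R}/\|P\|_{2,R}$ is set equal to $0$ when $P\equiv 0$. *)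

(* Defs.v *)
From HB Require Import structures.
From mathcomp Require Import all_boot all_order all_algebra finmap complex.
From mathcomp Require Import all_classical all_reals all_analysis.

Set Implicit Arguments.
Unset Strict Implicit.
Unset Printing Implicit Defensive.

Import Order.TTheory GRing.Theory Num.Theory.
Import numFieldNormedType.Exports.

Local Open Scope classical_set_scope.
Local Open Scope ring_scope.
Local Open Scope complex_scope.

(* The Borel sigma-algebra on R[i]; the carrier is convertible to R[i]. The
   library attaches the topology of the modulus to the alias R[i]^o. *)
Definition complexBorel (R : realType) := g_sigma_algebraType (@open R[i]^o).

(* Equality of laws is only meaningful on measurable sets: off them, P takes
   unspecified values. *)
Definition identically_distributed d d' (T : measurableType d)
    (T' : measurableType d') (R : realType) (P : probability T R)
    (I : Type) (X : I -> {RV P >-> T'}) : Prop :=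
  forall i j (B : set T'), measurable B ->
    distribution P (X i) B = distribution P (X j) B.
Arguments identically_distributed {d d' T T' R} P {I} X.

Definition mutually_independent d d' (T : measurableType d)
    (T' : measurableType d') (R : realType) (P : probability T R)
    (I : choiceType) (X : I -> {RV P >-> T'}) : Prop :=
  forall (J : {fset I}) (B : I -> set T'), (forall i, measurable (B i)) ->
    P (\bigcap_(i in [set` J]) X i @^-1` B i) =
      (\prod_(i <- J) P (X i @^-1` B i))%E.
Arguments mutually_independent {d d' T T' R} P {I} X.

Definition has_density_on (R : realType) (nu : set R -> \bar R) (D : set R)
    (f : R -> R) : Prop :=
  [/\ measurable_fun D f, (forall x, D x -> 0 <= f x) &
      forall B, measurable B -> B `<=` D ->
        nu B = (\int[lebesgue_measure]_(x in B) (f x)%:E)%E].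

Definition cvg_in_probability d (T : measurableType d) (R : realType)
    (P : probability T R) (X : nat -> T -> R) (l : R) : Prop :=
  forall e : R, 0 < e -> P [set w | e < `|X n w - l|] @[n --> \oo] --> 0%E.

Definition circle_point (R : realType) (r t : R) : R[i] :=
  (r * cos t) +i* (r * sin t).

(* Normc.normc is the modulus with values in R rather than in R[i]. *)
Definition circle_norm2 (R : realType) (r : R) (p : {poly R[i]}) : R :=
  Num.sqrt ((2 * pi)^-1 *
    \int[lebesgue_measure]_(t in `[0, 2 * pi])
      Normc.normc p.[circle_point r t] ^+ 2).

Definition deriv_ratio (R : realType) (r : R) (p : {poly R[i]}) : R :=
  if p == 0 then 0 else circle_norm2 r p^`() / circle_norm2 r p.

Definition random_poly (R : realType) (T : Type)
    (A : nat -> T -> complexBorel R) (n : nat) (w : T) : {poly R[i]} :=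
  \poly_(k < n.+1) (A k w : R[i]).

(* Main.v *)
(* By Parseval, with [a k = |A k|^2], the ratio is [r^-1 * sqrt (N / S)] where
   [S = \sum_k a k * r^(2k)] and [N = \sum_k k^2 * a k * r^(2k)], so it never
   exceeds [n / r]. Keeping only the last term of [S],
   [n - sqrt (N / S) <= 2 * Z / a n] with
   [Z = \sum_k (n - k) * r^(-2(n - k)) * a k], whose expectation is bounded
   uniformly in [n] because [r > 1]. As [a n] has the law of [a 0], which has no
   atom at 0, splitting according to [a n <= x] and applying Markov's inequality
   to [Z] gives convergence in probability; boundedness gives that of the
   expectations. *)
Require Import Defs.
From HB Require Import structures.
From mathcomp Require Import all_boot all_order all_algebra finmap complex.
From mathcomp Require Import all_classical all_reals all_analysis.
From mathcomp Require Import measurable_realfun ring lra.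

Import Order.TTheory GRing.Theory Num.Theory.
Import numFieldNormedType.Exports.

Local Open Scope classical_set_scope.
Local Open Scope ring_scope.
Local Open Scope complex_scope.

(** * Parseval's identity on the circle of radius [r] *)

Section parseval.
Context {R : realType}.
Implicit Types (r t : R) (c z : R[i]) (p q : {poly R[i]}).

Lemma sqr_normcE z :
  Normc.normc z ^+ 2 = complex.Re z ^+ 2 + complex.Im z ^+ 2.
Proof. by case: z => a b /=; rewrite sqr_sqrtr// addr_ge0// sqr_ge0. Qed.

(** De Moivre's formula, from the addition formulas for [cos] and [sin]. *)
Lemma circle_pointX r t n :
  circle_point r t ^+ n = circle_point (r ^+ n) (n%:R * t).
Proof.
elim: n => [|n IH].
  by rewrite /circle_point !expr0 mul0r cos0 sin0 mulr1 mulr0.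
rewrite exprS IH /circle_point; apply/eqP; rewrite eq_complex /=.
rewrite -[in X in _ && X]natr1 -[n.+1%:R]natr1 !mulrDl !mul1r cosD sinD exprS.
by apply/andP; split; apply/eqP; ring.
Qed.

Lemma sqr_normc_circle_point r t : Normc.normc (circle_point r t) ^+ 2 = r ^+ 2.
Proof.
by rewrite sqr_normcE /= !exprMn -mulrDr cos2Dsin2 mulr1.
Qed.

(** Both parts are treated together because multiplication by the circle point in the Horner step
    mixes them. *)
Lemma continuous_Re_Im_horner_circle r p :
  continuous (fun t => complex.Re p.[circle_point r t]) /\
  continuous (fun t => complex.Im p.[circle_point r t]).
Proof.
elim/poly_ind: p => [|p c [cRe cIm]].
  by split; under eq_fun do rewrite horner0 /=; exact: cst_continuous.
have Ec : continuous (fun t : R => r * cos t).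
  by move=> t; apply: cvgM; [exact: cvg_cst|exact: continuous_cos].
have Es : continuous (fun t : R => r * sin t).
  by move=> t; apply: cvgM; [exact: cvg_cst|exact: continuous_sin].
split.
  have -> : (fun t => complex.Re (p * 'X + c%:P).[circle_point r t]) =
      fun t => complex.Re p.[circle_point r t] * (r * cos t)
               - complex.Im p.[circle_point r t] * (r * sin t) + complex.Re c.
    by apply/funext => t; rewrite hornerMXaddC; case: c => c1 c2; case: (p.[_]).
  move=> t; apply: cvgD; last exact: cvg_cst.
  by apply: cvgB; apply: cvgM; [exact: cRe|exact: Ec|exact: cIm|exact: Es].
have -> : (fun t => complex.Im (p * 'X + c%:P).[circle_point r t]) =
    fun t => complex.Re p.[circle_point r t] * (r * sin t)
             + complex.Im p.[circle_point r t] * (r * cos t) + complex.Im c.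
  by apply/funext => t; rewrite hornerMXaddC; case: c => c1 c2; case: (p.[_]).
move=> t; apply: cvgD; last exact: cvg_cst.
by apply: cvgD; apply: cvgM; [exact: cRe|exact: Es|exact: cIm|exact: Ec].
Qed.

Lemma continuous_integrable_segment (f : R -> R) (a b : R) : continuous f ->
  lebesgue_measure.-integrable `[a, b] (EFin \o f).
Proof.
move=> cf; apply: continuous_compact_integrable; first exact: segment_compact.
exact: continuous_subspaceT.
Qed.

Let mu := @lebesgue_measure R.
Let I : set (measurableTypeR R) := `[0, 2 * pi].

Let mI : measurable I.
Proof. exact: measurable_itv. Qed.

(** A monomial of positive degree has a primitive along the circle that is itself
    [2 * pi]-periodic. *)
Lemma Rintegral_Re_monomial_circle r c m :
  Rintegral mu I (fun t => complex.Re (c * circle_point r t ^+ m.+1)) = 0.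
Proof.
have m0 : m.+1%:R != 0 :> R by rewrite pnatr_eq0.
pose k : R := m.+1%:R.
case: c => a b.
(* The primitive read off from De Moivre's formula; dividing by [k] is possible because the exponent
   is positive. *)
pose F t := r ^+ m.+1 / k * (a * sin (k * t) + b * cos (k * t)).
have dF t : is_derive t 1 F (r ^+ m.+1 * (a * cos (k * t) - b * sin (k * t))).
  rewrite /F; apply: is_derive_eq.
  by rewrite /GRing.scale /= /k; field; rewrite nat1r.
have -> : (fun t => complex.Re ((a +i* b) * circle_point r t ^+ m.+1)) =
    (fun t => r ^+ m.+1 * (a * cos (k * t) - b * sin (k * t))).
  by apply/funext => t; rewrite circle_pointX /= /k; ring.
have cF : continuous F.
  by move=> t; apply/differentiable_continuous/derivable1_diffP; apply: ex_derive.
have cdF : continuous (fun t => r ^+ m.+1 * (a * cos (k * t) - b * sin (k * t))).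
  move=> t; apply/differentiable_continuous/derivable1_diffP; apply: ex_derive.
rewrite /Rintegral (@continuous_FTC2 _ _ F).
(* At [t = 2 * pi] the argument [k * t] has run through [m.+1] full periods, so [F] takes the same
   value at both ends. *)
- rewrite /F mulr0 /k (_ : m.+1%:R * (2 * pi) = 0 + (pi *+ 2) *+ m.+1); last first.
    by rewrite add0r !mulr_natl.
  by rewrite (periodicn (@cosD2pi R)) (periodicn (@sinD2pi R)) subee.
- by rewrite mulr_gt0// pi_gt0.
- exact: continuous_subspaceT.
- split.
  + by move=> t _; apply: ex_derive.
  + by apply: cvg_at_right_filter; exact: cF.
  + by apply: cvg_at_left_filter; exact: cF.
- by move=> t _; rewrite derive1E; apply: derive_val.
Qed.

(** The factor of degree [m.+1] leaves no constant term. The exponent is general because each Horner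
    step moves one ['X] from the polynomial into it. *)
Lemma Rintegral_Re_horner_circle r q m :
  Rintegral mu I
    (fun t => complex.Re (q.[circle_point r t] * circle_point r t ^+ m.+1)) = 0.
Proof.
have int p : mu.-integrable I
    (EFin \o fun t => complex.Re p.[circle_point r t]).
  apply: continuous_integrable_segment.
  by have [] := continuous_Re_Im_horner_circle r p.
elim/poly_ind: q m => [|q c IH] m.
  under eq_Rintegral do rewrite horner0 mul0r raddf0.
  by rewrite Rintegral_cst// mul0r.
under eq_Rintegral => t _.
  rewrite !hornerE mulrDl -mulrA -exprS raddfD /=.
  over.
rewrite RintegralD//; last 2 first.
- by have := int (q * 'X^(m.+2)); under eq_fun do rewrite hornerM hornerXn.
- by have := int (c%:P * 'X^(m.+1)); under eq_fun do
    rewrite hornerM hornerXn hornerC.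
by rewrite IH Rintegral_Re_monomial_circle addr0.
Qed.

(** Induction on [p = q * 'X + c]: on the circle [|q z + c| ^ 2] is [r ^ 2 |q| ^ 2 + |c| ^ 2] plus a
    cross term of mean zero. Bounding the size by [n] allows vanishing top coefficients. *)
Lemma Rintegral_sqr_normc_circle r p n : (size p <= n)%N ->
  Rintegral mu I (fun t => Normc.normc p.[circle_point r t] ^+ 2) =
  2 * pi * \sum_(i < n) Normc.normc p`_i ^+ 2 * r ^+ (2 * i).
Proof.
have int q : mu.-integrable I
    (EFin \o fun t => Normc.normc q.[circle_point r t] ^+ 2).
  apply: continuous_integrable_segment.
  under eq_fun do rewrite sqr_normcE.
  have [cR cI] := continuous_Re_Im_horner_circle r q.
  move=> t; apply: cvgD; rewrite [X in X @ _ --> _]/=.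
    under eq_fun do rewrite expr2.
    by rewrite expr2; apply: cvgM; exact: cR.
  under eq_fun do rewrite expr2.
  by rewrite expr2; apply: cvgM; exact: cI.
have int' q : mu.-integrable I
    (EFin \o fun t => complex.Re q.[circle_point r t]).
  apply: continuous_integrable_segment.
  by have [] := continuous_Re_Im_horner_circle r q.
elim: n p => [|n IH] p.
  rewrite leqn0 size_poly_eq0 => /eqP ->.
  rewrite big_ord0 mulr0; under eq_Rintegral do
    rewrite horner0 Normc.normc0 expr0n /=.
  by rewrite Rintegral_cst// mul0r.
move=> sp.
(* [q] is the quotient of [p] by ['X]. *)
pose q := drop_poly 1 p; pose c := p`_0.
have pE : p = q * 'X + c%:P.
  rewrite -{1}(poly_take_drop 1 p) addrC expr1; congr (_ + _).
  by apply/polyP => -[|i]; rewrite coef_take_poly coefC.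
have expand t : Normc.normc p.[circle_point r t] ^+ 2 =
   r ^+ 2 * Normc.normc q.[circle_point r t] ^+ 2 + Normc.normc c ^+ 2 +
   2 * complex.Re (((c^*)%C%:P * q).[circle_point r t] * circle_point r t ^+ 1).
  rewrite {1}pE hornerMXaddC hornerM hornerC -(sqr_normc_circle_point r t) expr1.
  rewrite !sqr_normcE.
  case: (q.[circle_point r t]) => q1 q2; case: (circle_point r t) => z1 z2.
  by case: (c) => c1 c2 /=; ring.
under eq_Rintegral do rewrite expand.
have i1 := int q.
have i2 : mu.-integrable I (EFin \o fun t => complex.Re
    (((c^*)%C%:P * q).[circle_point r t] * circle_point r t ^+ 1)).
  by have := int' ((c^*)%C%:P * q * 'X); under eq_fun do rewrite hornerM hornerX.
have i0 : mu.-integrable I (EFin \o fun=> Normc.normc c ^+ 2).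
  by apply: continuous_integrable_segment; exact: cst_continuous.
have iZ (k : R) (f : R -> R) : mu.-integrable I (EFin \o f) ->
    mu.-integrable I (EFin \o fun t => k * f t).
  by move=> fi; exact: (integrableZl mI k fi).
rewrite RintegralD//; last 2 first.
- rewrite [X in _.-integrable _ X](_ : _ =
    (EFin \o (fun t => r ^+ 2 * Normc.normc q.[circle_point r t] ^+ 2)) \+
    (EFin \o fun=> Normc.normc c ^+ 2)); last exact/funext.
  by apply: integrableD => //; exact: iZ.
- exact: iZ.
rewrite RintegralD//; last exact: iZ.
rewrite Rintegral_cst// !RintegralZl// Rintegral_Re_horner_circle mulr0 addr0 IH; last first.
  by rewrite size_drop_poly leq_subLR add1n.
have muI : fine (mu I) = 2 * pi.
  by rewrite /mu /I lebesgue_measure_itv/= lte_fin mulr_gt0 ?pi_gt0// sube0.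
have -> : \sum_(i < n.+1) Normc.normc p`_i ^+ 2 * r ^+ (2 * i) =
    Normc.normc c ^+ 2 +
    r ^+ 2 * \sum_(i < n) Normc.normc q`_i ^+ 2 * r ^+ (2 * i).
  rewrite big_ord_recl /= muln0 expr0 mulr1 mulr_sumr; congr (_ + _).
  apply: eq_bigr => i _.
  by rewrite coef_drop_poly addn1 /bump leq0n add1n mulnS exprD mulrCA.
by rewrite muI; ring.
Qed.

Lemma circle_norm2E r p n : (size p <= n)%N ->
  circle_norm2 r p =
  Num.sqrt (\sum_(i < n) Normc.normc p`_i ^+ 2 * r ^+ (2 * i)).
Proof.
move=> sp; rewrite /circle_norm2 (@Rintegral_sqr_normc_circle r p n sp).
by rewrite mulKf// mulf_neq0 ?pnatr_eq0// gt_eqF// pi_gt0.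
Qed.

End parseval.

(** * Deterministic inequalities for the weighted coefficient sums *)

Section weighted_sums.
Context {R : realType}.
Implicit Types (r q : R) (a : nat -> R) (n : nat).

Definition energy r a n := \sum_(k < n.+1) a k * r ^+ (2 * k).

(** For squared moduli [a k] this is [r ^ 2] times the squared circle norm of the derivative;
    keeping the exponent [2 * k] makes it comparable with [energy] term by term. *)
Definition deriv_energy r a n :=
  \sum_(k < n.+1) k%:R ^+ 2 * (a k * r ^+ (2 * k)).

(* Dividing by [r ^+ (2 * n)] turns the weight [n - k], which bounds
   [(n ^+ 2 - k ^+ 2) / (2 * n)], into a summable one. *)
Definition lag_energy r a n :=
  \sum_(k < n.+1) (n - k)%:R * r ^- (2 * (n - k)) * a k.

(** Clearing the denominator makes the closed form valid for every [q], and each induction step a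
    ring identity. *)
Lemma sum_geo_weighted q n :
  (1 - q) ^+ 2 * (\sum_(j < n) j%:R * q ^+ j) =
  q - q ^+ n * (q + n%:R * (1 - q)).
Proof.
elim: n => [|n IH]; first by rewrite big_ord0; ring.
by rewrite big_ord_recr /= mulrDr IH [q ^+ n.+1]exprS -[n.+1%:R]natr1; ring.
Qed.

(** The subtracted term of the closed form is nonnegative, which gives a bound uniform in [n]. *)
Lemma sum_geo_weighted_le q n : 0 <= q < 1 ->
  \sum_(j < n) j%:R * q ^+ j <= q / (1 - q) ^+ 2.
Proof.
move=> /andP[q0 q1]; have q1' : 0 < 1 - q by rewrite subr_gt0.
rewrite ler_pdivlMr ?exprn_gt0// mulrC sum_geo_weighted lerBlDr lerDl.
by rewrite mulr_ge0 ?exprn_ge0// addr_ge0// mulr_ge0// ltW.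
Qed.

Section bounds.
Variables (r : R) (a : nat -> R) (n : nat).
Hypotheses (r0 : 0 < r) (a0 : forall k, 0 <= a k).

Let w0 k : 0 <= a k * r ^+ (2 * k).
Proof. by rewrite mulr_ge0// exprn_ge0// ltW. Qed.

Lemma energy_ge0 : 0 <= energy r a n.
Proof. by rewrite sumr_ge0. Qed.

Lemma deriv_energy_ge0 : 0 <= deriv_energy r a n.
Proof. by rewrite sumr_ge0// => k _; rewrite mulr_ge0// sqr_ge0. Qed.

Lemma lag_energy_ge0 : 0 <= lag_energy r a n.
Proof.
by rewrite sumr_ge0// => k _; rewrite !mulr_ge0// invr_ge0 exprn_ge0// ltW.
Qed.

Lemma deriv_energy_le : deriv_energy r a n <= n%:R ^+ 2 * energy r a n.
Proof.
rewrite mulr_sumr ler_sum// => k _; rewrite ler_wpM2r//.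
by rewrite lerXn2r ?nnegrE// ler_nat -ltnS.
Qed.

(** Termwise, [n ^ 2 - k ^ 2 = (n - k) (n + k) <= 2 n (n - k)]. *)
Lemma energy_gap_le :
  n%:R ^+ 2 * energy r a n - deriv_energy r a n <=
  2 * n%:R * r ^+ (2 * n) * lag_energy r a n.
Proof.
rewrite !mulr_sumr -sumrB ler_sum// => k _.
have kn : (k <= n)%N by rewrite -ltnS.
have -> : 2 * n%:R * r ^+ (2 * n) * ((n - k)%:R * r ^- (2 * (n - k)) * a k) =
    2 * n%:R * (n - k)%:R * (a k * r ^+ (2 * k)) :> R.
  rewrite (_ : 2 * n = 2 * (n - k) + 2 * k)%N; last by rewrite -mulnDr subnK.
  by rewrite exprD; field; rewrite expf_neq0// lt0r_neq0.
rewrite -mulrBl ler_wpM2r// natrB// subr_sqr [leLHS]mulrC ler_wpM2r//.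
  by rewrite subr_ge0 ler_nat.
by rewrite mulr_natl mulr2n lerD2l ler_nat.
Qed.

Lemma energy_ge_last : a n * r ^+ (2 * n) <= energy r a n.
Proof. by rewrite /energy big_ord_recr lerDr sumr_ge0. Qed.

Lemma energy_ratio_le : Num.sqrt (deriv_energy r a n / energy r a n) <= n%:R.
Proof.
rewrite -[leRHS]ger0_norm// -sqrtr_sqr ler_wsqrtr//.
(* With zero energy the quotient is [0], since the inverse of [0] is [0]. *)
have [->|E0] := eqVneq (energy r a n) 0; first by rewrite invr0 mulr0 sqr_ge0.
by rewrite ler_pdivrMr ?lt0r ?E0 ?energy_ge0// deriv_energy_le.
Qed.

Lemma energy_ratio_ge : (0 < n)%N -> 0 < a n ->
  n%:R - Num.sqrt (deriv_energy r a n / energy r a n) <=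
  2 * lag_energy r a n / a n.
Proof.
move=> n0 an0; have N0 : 0 < n%:R :> R by rewrite ltr0n.
set E := energy r a n; set D := deriv_energy r a n.
have rn : 0 < r ^+ (2 * n) by exact: exprn_gt0.
have E0 : 0 < E by rewrite (lt_le_trans _ energy_ge_last)// mulr_gt0.
set s := Num.sqrt _.
have s0 : 0 <= s by exact: sqrtr_ge0.
have s2 : s ^+ 2 = D / E by rewrite sqr_sqrtr// divr_ge0 ?deriv_energy_ge0 ?energy_ge0.
have sn : s <= n%:R by exact: energy_ratio_le.
(* Divide the energy gap by [E] and bound [E] below by its last term; the powers [r ^+ (2 * n)]
   cancel. *)
have gap : n%:R ^+ 2 - s ^+ 2 <= 2 * n%:R * lag_energy r a n / a n.
  rewrite s2 -[n%:R ^+ 2](mulfK (lt0r_neq0 E0)) -mulrBl.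
  rewrite ler_pdivrMr// (le_trans energy_gap_le)//.
  have -> : 2 * n%:R * r ^+ (2 * n) * lag_energy r a n =
     2 * n%:R * lag_energy r a n / a n * (a n * r ^+ (2 * n)).
    by field; exact: lt0r_neq0.
  rewrite ler_wpM2l ?energy_ge_last//.
  by rewrite !mulr_ge0// ?lag_energy_ge0// invr_ge0 ltW.
have gapE : 2 * n%:R * lag_energy r a n / a n =
    2 * lag_energy r a n / a n * n%:R.
  by field; exact: lt0r_neq0.
(* Factor [n ^ 2 - s ^ 2 = (n - s) (n + s)] and use [n + s >= n]. *)
rewrite -(ler_pM2r N0) -gapE (le_trans _ gap)//.
by rewrite subr_sqr ler_wpM2l ?subr_ge0// lerDl.
Qed.

End bounds.

Lemma deriv_ratioE r (c : nat -> R[i]) n : 0 < r ->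
  let a k := Normc.normc (c k) ^+ 2 in
  deriv_ratio r (\poly_(k < n.+1) c k) =
  r^-1 * Num.sqrt (deriv_energy r a n / energy r a n).
Proof.
move=> r0 a; set p := \poly_(k < n.+1) c k.
have coefp k : (k < n.+1)%N -> p`_k = c k by move=> kn; rewrite coef_poly kn.
have sp : (size p <= n.+1)%N by exact: size_poly.
have a0 k : 0 <= a k by exact: sqr_ge0.
have pn : circle_norm2 r p = Num.sqrt (energy r a n).
  rewrite (circle_norm2E r _ _ sp); congr Num.sqrt; apply: eq_bigr => k _.
  by rewrite coefp.
have pn' : circle_norm2 r p^`() = r^-1 * Num.sqrt (deriv_energy r a n).
  rewrite (@circle_norm2E _ r _ n); last first.
    by rewrite (leq_trans (size_poly _ _))// -ltnS; case: (size p) sp.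
  (* The index [0] contributes nothing; shifting the others by one costs a factor [r ^ 2], hence the
     [r^-1] outside the root. *)
  rewrite /deriv_energy big_ord_recl expr0n mul0r add0r.
  rewrite -(ger0_norm (ltW (_ : 0 < r^-1))) ?invr_gt0//.
  rewrite -sqrtr_sqr -sqrtrM ?sqr_ge0//.
  congr Num.sqrt; rewrite mulr_sumr; apply: eq_bigr => k _.
  rewrite coef_deriv coefp ?ltnS// lift0 normcMn -mulr_natl exprMn /a.
  rewrite mulnS exprD; field; exact: lt0r_neq0.
rewrite /deriv_ratio pn pn' sqrtrM; last exact: deriv_energy_ge0.
rewrite -mulrA sqrtrV; last exact: energy_ge0.
(* When [p = 0] the right-hand side is [sqrt (0 / 0) = 0], the convention. *)
case: eqP => // p0; suff -> : energy r a n = 0 by rewrite sqrtr0 invr0 !mulr0.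
by apply: big1 => k _; rewrite /a -coefp// p0 coef0 Normc.normc0 expr0n mul0r.
Qed.

End weighted_sums.

(** * From convergence in probability to convergence of expectations *)

Section in_probability.
Context {d : measure_display} {T : measurableType d} {R : realType}.
Variable P : probability T R.

Lemma measurable_deviation (X : T -> R) (l e : R) :
  measurable_fun setT X -> measurable [set w | e < `|X w - l|].
Proof.
move=> mX; rewrite -[X in measurable X]setTI.
have -> : [set w | e < `|X w - l|] = (fun w => `|X w - l|) @^-1` `]e, +oo[.
  by apply/seteqP; split => w /=; rewrite in_itv/= andbT.
apply: (_ : measurable_fun setT (fun w => `|X w - l|)) => //.
by apply: measurableT_comp => //; apply: measurable_funB.
Qed.

(** As [X n <= l], only a lower bound on the expectation is at stake: [X n] falls short of [l] by
    more than [e / 2] only on an event of small probability, and there by at most [l]. *)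
Lemma cvg_in_probability_expectation (X : nat -> T -> R) (l : R) :
  (forall n, measurable_fun setT (X n)) -> (forall n w, 0 <= X n w <= l) ->
  cvg_in_probability P X l ->
  (\int[P]_w (X n w)%:E)%E @[n --> \oo] --> l%:E.
Proof.
move=> mX X0l cX.
have X0 n w : 0 <= X n w by case/andP: (X0l n w).
have Xl n w : X n w <= l by case/andP: (X0l n w).
have l0 : 0 <= l by exact: le_trans (X0 0%N point) (Xl 0%N point).
have mXE n : measurable_fun setT (EFin \o X n) by exact/measurable_EFinP.
have Il n : (\int[P]_w (X n w)%:E <= l%:E)%E.
  rewrite -[leRHS]mule1 -(@probability_setT _ _ _ P) -integral_cst//.
  apply: ge0_le_integral => //; first by move=> w _; rewrite lee_fin.
  - exact: mXE.
  - by move=> w _; rewrite lee_fin.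
have I0 n : (0 <= \int[P]_w (X n w)%:E)%E.
  by apply: integral_ge0 => w _; rewrite lee_fin.
have Ifin n : (\int[P]_w (X n w)%:E)%E \is a fin_num.
  by rewrite ge0_fin_numE// (le_lt_trans (Il n))// ltry.
apply/fine_cvgP; split; first exact: nearW.
apply/cvgrPdist_le => e e0.
have e2 : 0 < e / 2 by rewrite divr_gt0.
pose B n := [set w | e / 2 < `|X n w - l|].
have mB n : measurable (B n) by exact: measurable_deviation.
have lower n : (l%:E <= \int[P]_w (X n w)%:E + ((e / 2)%:E + l%:E * P (B n)))%E.
  have mI : measurable_fun setT (EFin \o fun w => l * \1_(B n) w).
    by apply/measurable_EFinP; exact: measurable_funM.
  have -> : (l%:E * P (B n) = \int[P]_w (l * \1_(B n) w)%:E)%E.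
    under eq_integral do rewrite EFinM.
    rewrite ge0_integralZl_EFin//; last exact/measurable_EFinP.
    by rewrite integral_indic// setIT.
  have -> : ((e / 2)%:E = \int[P]_w cst (e / 2)%:E w)%E.
    by rewrite integral_cst//= probability_setT mule1.
  have I1 (w : T) : setT w -> (0 <= cst (e / 2)%:E w)%E by rewrite lee_fin ltW.
  have I2 w : setT w -> (0 <= (l * \1_(B n) w)%:E)%E by rewrite lee_fin mulr_ge0.
  have I3 w : setT w -> (0 <= (X n w)%:E)%E by rewrite lee_fin.
  rewrite -(ge0_integralD P measurableT I1 _ I2 mI)//.
  rewrite -(ge0_integralD P measurableT I3 (mXE n))//; last 2 first.
  - by move=> w Tw; rewrite adde_ge0 ?I1 ?I2.
  - exact: emeasurable_funD.
  rewrite -[leLHS]mule1 -(@probability_setT _ _ _ P) -integral_cst//.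
  apply: ge0_le_integral => //.
    by apply: emeasurable_funD; [exact: mXE|exact: emeasurable_funD].
  (* On [B n] the indicator term supplies [l] by itself; off [B n], [X n w >= l - e / 2]. *)
  move=> w _; rewrite -!EFinD lee_fin /= indicE.
  have [wB|/negP] := boolP (w \in B n).
    by rewrite mulr1 addrA lerDr addr_ge0// ltW.
  rewrite inE /B /= => /negP; rewrite -leNgt mulr0 addr0 => h.
  by move: (h); rewrite distrC ler_distl => /andP[]; lra.
(* Dividing by [l + 1] instead of [l] covers [l = 0]. *)
have l1 : 0 < l + 1 by rewrite ltr_wpDl.
have d0 : 0 < e / 2 / (l + 1) by rewrite divr_gt0.
have /fine_cvgP[_ /cvgrPdist_le /(_ _ d0)] := cX _ e2.
apply: filterS => n /=; rewrite sub0r normrN => Pn.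
have PB : fine (P (B n)) <= e / 2 / (l + 1) by rewrite (le_trans _ Pn)// ler_norm.
have := lower n; rewrite -(fineK (Ifin n)) -(fineK (fin_num_measure P _ (mB n))).
rewrite -EFinM -!EFinD lee_fin => low.
have := Il n; rewrite -(fineK (Ifin n)) lee_fin => up.
rewrite ger0_norm ?subr_ge0// lerBlDr.
have : l * fine (P (B n)) <= e / 2.
  apply: (@le_trans _ _ ((l + 1) * (e / 2 / (l + 1)))).
    by apply: ler_pM => //; [exact/fine_ge0|rewrite lerDl].
  by rewrite mulrC divfK// lt0r_neq0.
by move: low; lra.
Qed.

End in_probability.

(** Preimages of open rays are open: by the triangle inequality the ball around [z] of radius
    [normc z - x] stays where the modulus exceeds [x]. The radius is cast to [R[i]], where the norm
    of [R[i]^o] takes its values. *)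
Lemma measurable_normc {R : realType} :
  measurable_fun [set: complexBorel R] (@Normc.normc R).
Proof.
apply: (measurability _ (RGenOInfty.measurableE R)) => //.
move=> /= _ [_ [x ->] <-]; rewrite setTI; apply: sub_gen_smallest.
move=> z /=; rewrite in_itv /= andbT => xz.
have dz : 0 < (Normc.normc z - x)%:C by rewrite ltcR subr_gt0.
apply/nbhs_ballP; exists (Normc.normc z - x)%:C => //= y.
rewrite /ball /= in_itv /= andbT; rewrite normc_def ltcR => yz.
have : Normc.normc z <= Normc.normc (z - y) + Normc.normc y.
  by rewrite -{1}(subrK y z) le_normcD.
by move: yz; rewrite [X in X < _](_ : _ = Normc.normc (z - y)); [lra|case: (z - y)].
Qed.

(** * Probabilistic estimates for nonnegative coefficients [a k] *)

Section lag_estimate.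
Context {d : measure_display} {T : measurableType d} {R : realType}.
Variables (P : probability T R) (a : nat -> T -> R) (r : R).
Hypothesis (ma : forall k, measurable_fun setT (a k)).
Hypothesis (a0 : forall k w, 0 <= a k w).
Hypothesis (r1 : 1 < r).

Let r0 : 0 < r. Proof. exact: lt_trans r1. Qed.

Definition scaled_ratio n w : R :=
  r^-1 * (n%:R^-1 * Num.sqrt (deriv_energy r (a ^~ w) n / energy r (a ^~ w) n)).

Lemma measurable_scaled_ratio n : measurable_fun setT (scaled_ratio n).
Proof.
have mE : measurable_fun setT (fun w => energy r (a ^~ w) n).
  rewrite /energy; apply: measurable_sum => k; exact: measurable_funM.
have mD : measurable_fun setT (fun w => deriv_energy r (a ^~ w) n).
  rewrite /deriv_energy; apply: measurable_sum => k.
  by apply: measurable_funM => //; exact: measurable_funM.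
rewrite /scaled_ratio; do 2 apply: measurable_funM => //.
(* Root and inverse are rewritten as real powers, which are measurable; the two forms agree because
   the energies are nonnegative. *)
rewrite (_ : (fun w => _) = (fun x => x `^ 2^-1) \o
   (fun w => deriv_energy r (a ^~ w) n * (energy r (a ^~ w) n) `^ (-1))).
  apply: measurableT_comp; first exact: measurable_powR.
  apply: measurable_funM => //.
  by apply: (@measurableT_comp _ _ _ _ _ _ (fun x => x `^ (-1))) => //;
    exact: measurable_powR.
apply/funext => w /=; have E0 : 0 <= energy r (a ^~ w) n by exact: energy_ge0.
by rewrite powR_inv1// powR12_sqrt// divr_ge0// deriv_energy_ge0.
Qed.

Lemma scaled_ratio_ge0_le n w : 0 <= scaled_ratio n w <= r^-1.
Proof.
have ri0 : 0 <= r^-1 by rewrite invr_ge0 ltW.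
apply/andP; split; first by rewrite mulr_ge0// mulr_ge0// sqrtr_ge0.
rewrite ler_piMr//; case: n => [|n]; first by rewrite invr0 mul0r.
by rewrite mulrC ler_pdivrMr ?ltr0n// mul1r energy_ratio_le.
Qed.

(** By linearity the mean is [m] times a weighted geometric sum of ratio [r ^- 2 < 1]. *)
Lemma expectation_lag_energy_le n (m : R) :
  (forall k, \int[P]_w (a k w)%:E = m%:E)%E ->
  (\int[P]_w (lag_energy r (a ^~ w) n)%:E <=
   (r ^- 2 / (1 - r ^- 2) ^+ 2 * m)%:E)%E.
Proof.
move=> am.
have m0 : 0 <= m.
  by rewrite -lee_fin -(am 0%N); apply: integral_ge0 => w _; rewrite lee_fin.
have c0 k : 0 <= (n - k)%:R * r ^- (2 * (n - k)) :> R.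
  by rewrite mulr_ge0// invr_ge0 exprn_ge0// ltW.
under eq_integral do rewrite /lag_energy -sumEFin.
rewrite ge0_integral_sum//; last 2 first.
- by move=> k; apply/measurable_EFinP; exact: measurable_funM.
- by move=> k w _; rewrite lee_fin mulr_ge0.
under eq_bigr => k _.
  under eq_integral do rewrite EFinM.
  rewrite ge0_integralZl_EFin//; last 2 first.
  - by move=> w _; rewrite lee_fin.
  - exact/measurable_EFinP.
  rewrite am -EFinM.
  over.
rewrite sumEFin lee_fin -mulr_suml ler_wpM2r//.
(* Reversing the indices makes the lag [n - k] the summation variable. *)
rewrite (reindex_inj rev_ord_inj) /=.
under eq_bigr => k _.
  rewrite subSS subKn; last by rewrite -ltnS ltn_ord.
  rewrite exprM -exprVn.
  over.
by apply: sum_geo_weighted_le; rewrite invr_ge0 sqr_ge0 invf_lt1 ?exprn_gt0// exprn_egt1.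
Qed.

Lemma scaled_ratio_cvg (m : R) :
  (forall k, \int[P]_w (a k w)%:E = m%:E)%E ->
  (forall k x, P [set w | a k w <= x] = P [set w | a 0%N w <= x]) ->
  P [set w | a 0%N w <= 0] = 0%E ->
  cvg_in_probability P scaled_ratio r^-1.
Proof.
move=> am aP aP0 e e0.
have mle k x : measurable [set w | a k w <= x].
  rewrite -[X in measurable X]setTI.
  have -> : [set w | a k w <= x] = a k @^-1` `]-oo, x].
    by apply/seteqP; split => w /=; rewrite in_itv.
  exact: ma.
pose B n := [set w | e < `|scaled_ratio n w - r^-1|].
have mB n : measurable (B n).
  by apply: measurable_deviation; exact: measurable_scaled_ratio.
apply/fine_cvgP; split; first by apply: nearW => n; exact: (fin_num_measure P _ (mB n)).
apply/cvgrPdist_le => h h0.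
have h2 : 0 < h / 2 by rewrite divr_gt0.
(* Continuity of [P] from above along the events [a 0 <= 1 / (k + 1)], which decrease to a null
   event. This [x] does not depend on [n]. *)
have [x x0 Px] : exists2 x : R, 0 < x & fine (P [set w | a 0%N w <= x]) <= h / 2.
  pose F (k : nat) := [set w | a 0%N w <= k.+1%:R^-1].
  have capF : \bigcap_k F k = [set w | a 0%N w <= 0].
    apply/seteqP; split => w /=.
      move=> Fw; rewrite leNgt; apply/negP => aw.
      have [k _ /(_ k (leqnn k))] := (near_infty_natSinv_lt (PosNum aw)).
      by rewrite /= ltNge (Fw k I).
    by move=> aw k _; rewrite /F /= (le_trans aw)// invr_ge0.
  have : P \o F @ \oo --> P (\bigcap_k F k).
    apply: nonincreasing_cvg_mu => //.
    - by apply: le_lt_trans (probability_le1 _ (mle 0%N _)) _; rewrite ltry.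
    - by move=> k; exact: mle.
    - by rewrite capF.
    - move=> k1 k2 k12; apply/subsetPset => w; rewrite /F /= => aw.
      by rewrite (le_trans aw)// lef_pV2 ?posrE// ler_nat.
  rewrite capF aP0 => /fine_cvgP[_ /cvgrPdist_le /(_ _ h2)[N _ /(_ N (leqnn N))]].
  rewrite /= sub0r normrN => PN; exists N.+1%:R^-1; first by rewrite invr_gt0.
  by rewrite (le_trans _ PN)// ler_norm.
pose C := r ^- 2 / (1 - r ^- 2) ^+ 2 * m.
have key n : (0 < n)%N -> fine (P (B n)) <= h / 2 + 2 * C / (e * r * n%:R * x).
  move=> n0; have N0 : 0 < n%:R :> R by rewrite ltr0n.
  (* If [a n > x], a deviation above [e] gives [e * r * n < 2 * Z / a n], hence [Z >= y]. *)
  pose y := e * r * n%:R * x / 2.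
  have y0 : 0 < y by rewrite !mulr_gt0// invr_gt0.
  pose Z w := lag_energy r (a ^~ w) n.
  have Z0 w : 0 <= Z w by exact: lag_energy_ge0.
  have mZ : measurable_fun setT Z.
    by rewrite /Z /lag_energy; apply: measurable_sum => k; exact: measurable_funM.
  pose G := [set w | y <= Z w].
  have mG : measurable G.
    rewrite -[X in measurable X]setTI.
    have -> : G = Z @^-1` `[y, +oo[.
      by apply/seteqP; split => w /=; rewrite /G /= in_itv/= andbT.
    exact: mZ.
  have sub : B n `<=` [set w | a n w <= x] `|` G.
    move=> w; rewrite /B /= => eB; have [|xa] := leP (a n w) x; first by left.
    right; rewrite /G /=; have an0 : 0 < a n w by exact: lt_trans xa.
    have /andP[_ ler] := scaled_ratio_ge0_le n w.
    move: eB; rewrite ler0_norm ?subr_le0// opprB => eB.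
    have := @energy_ratio_ge R r (a ^~ w) n r0 (a0^~ w) n0 an0.
    set s := Num.sqrt _ => ge.
    have eqs : r^-1 - scaled_ratio n w = (n%:R - s) / (r * n%:R).
      by rewrite /scaled_ratio -/s; field; rewrite !lt0r_neq0.
    move: eB; rewrite eqs ltr_pdivlMr ?mulr_gt0// => eB.
    have : e * (r * n%:R) <= 2 * Z w / a n w by rewrite (le_trans (ltW eB)).
    rewrite ler_pdivlMr// => eZ; rewrite /y ler_pdivrMr// [leRHS]mulrC.
    apply: le_trans eZ; rewrite -[e * r * _]mulrA.
    by rewrite ler_wpM2l ?ltW// !mulr_gt0.
  have PG : fine (P G) <= 2 * C / (e * r * n%:R * x).
    have -> : 2 * C / (e * r * n%:R * x) = C / y.
      by rewrite /y; field; rewrite !lt0r_neq0.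
    rewrite ler_pdivlMr// mulrC -lee_fin EFinM fineK ?fin_num_measure//.
    apply: le_trans (expectation_lag_energy_le n m am).
    (* Markov's inequality for [Z] at level [y]. *)
    have := @le_integral_comp_abse _ T R P setT measurableT (EFin \o Z) y id
      (@measurable_id _ _ _) (fun _ h => h) (fun x y _ _ h => h).
    rewrite setTI => /(_ _ y0); under eq_set do rewrite /= ger0_norm// lee_fin.
    move=> /(_ _) H; apply: le_trans (H _) _; first exact/measurable_EFinP.
    by under eq_integral do rewrite /= ger0_norm//.
  have : (P (B n) <= P [set w | (a n w <= x)%R] + P G)%E.
    apply: le_trans (measureU2 _ _ _) => //.
    by apply: le_measure => //; rewrite inE//; exact: measurableU.
  (* Equality in law replaces [a n] by [a 0], for which [x] was chosen. *)
  rewrite aP -(fineK (fin_num_measure P _ (mB n))) -(fineK (fin_num_measure P _ mG)).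
  rewrite -(fineK (fin_num_measure P _ (mle 0%N x))) -EFinD lee_fin => /le_trans; apply.
  exact: lerD.
have C0 : 0 <= C.
  rewrite /C mulr_ge0//; last first.
    by rewrite -lee_fin -(am 0%N); apply: integral_ge0 => w _; rewrite lee_fin.
  by rewrite divr_ge0 ?invr_ge0 ?sqr_ge0.
near=> n.
rewrite sub0r normrN ger0_norm ?fine_ge0//.
have n0 : (0 < n)%N by near: n; exact: nbhs_infty_gt.
apply: le_trans (key n n0) _.
have N0 : 0 < n%:R :> R by rewrite ltr0n.
(* The Markov term decays like [1 / n], so it is eventually below the remaining [h / 2]. *)
rewrite -lerBrDl (_ : h - h / 2 = h / 2); last by lra.
rewrite ler_pdivrMr ?mulr_gt0//.
have -> : h / 2 * (e * r * n%:R * x) = (h / 2 * (e * r * x)) * n%:R by ring.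
rewrite [leRHS]mulrC -ler_pdivrMr ?mulr_gt0//.
by near: n; exact: nbhs_infty_ger.
Unshelve. all: by end_near. Qed.

End lag_estimate.

(** * Passage from the random coefficients to their squared moduli *)

Theorem theorem5 (R : realType) (d : measure_display) (T : measurableType d)
    (P : probability T R) (A : nat -> {RV P >-> complexBorel R})
    (hindep : mutually_independent P A)
    (hident : identically_distributed P A)
    (hA0 : (P [set w | (A 0%N w : R[i]) = 0%R] < 1)%E)
    (hL2 : ('E_P[fun w => (Normc.normc (A 0%N w) ^+ 2)%R] < +oo)%E)
    (eps : R) (heps : 0 < eps)
    (hdens : exists f : R -> R,
      has_density_on (pushforward P (fun w => Normc.normc (A 0%N w) ^+ 2))
        `[0, eps] f
      /\ [bounded f x | x in `[0, eps]])
    (r : R) (hr : 1 < r) :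
  cvg_in_probability P
    (fun n w => n%:R^-1 * deriv_ratio r (random_poly A n w)) r^-1
  /\
  ((n%:R^-1)%:E * 'E_P[fun w => deriv_ratio r (random_poly A n w)])%E
    @[n --> \oo] --> (r^-1)%:E.
Proof.
have r0 : 0 < r by exact: lt_trans hr.
pose a k w := Normc.normc (A k w : R[i]) ^+ 2.
have msq : measurable_fun setT (fun z : complexBorel R => Normc.normc z ^+ 2).
  by apply: measurable_funX; exact: measurable_normc.
have ma k : measurable_fun setT (a k).
  exact: (measurableT_comp msq (measurable_funPT (A k))).
have a0 k w : 0 <= a k w by exact: sqr_ge0.
have fE n w : n%:R^-1 * deriv_ratio r (random_poly A n w) = scaled_ratio a r n w.
  by rewrite /random_poly (deriv_ratioE _ (fun k => A k w : R[i]))// mulrCA.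
(* Means are compared by integrating against the common law of the coefficients. *)
have Ea k : (\int[P]_w (a k w)%:E = \int[P]_w (a 0%N w)%:E)%E.
  have toD j : (\int[P]_w (a j w)%:E =
      \int[distribution P (A j)]_z (Normc.normc z ^+ 2)%:E)%E.
    rewrite ge0_integral_distribution//; first exact/measurable_EFinP.
    by move=> z; rewrite lee_fin sqr_ge0.
  rewrite !toD; apply: eq_measure_integral => B mB _; exact: hident.
have aP k x : P [set w | a k w <= x] = P [set w | a 0%N w <= x].
  apply: (hident k 0%N [set z : complexBorel R | Normc.normc z ^+ 2 <= x]).
  rewrite -[X in measurable X]setTI.
  have -> : [set z : complexBorel R | Normc.normc z ^+ 2 <= x] =
      (fun z => Normc.normc z ^+ 2) @^-1` `]-oo, x].
    by apply/seteqP; split => z /=; rewrite in_itv.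
  exact: msq.
(* A law with a density on [[0, eps]] gives the singleton [0], of Lebesgue measure zero, no mass. *)
have aP0 : P [set w | a 0%N w <= 0] = 0%E.
  have [f [[_ _ /(_ [set 0])]]] := hdens.
  rewrite integral_set1 => nu0 _; rewrite -[RHS]nu0//.
    congr (P _); apply/seteqP; split => w /=.
      by rewrite le_eqVlt ltNge a0 orbF => /eqP.
    by move=> aw0; rewrite /a aw0.
  by move=> x /= ->; rewrite in_itv/= lexx ltW.
have Em : exists m : R, forall k, (\int[P]_w (a k w)%:E = m%:E)%E.
  exists (fine (\int[P]_w (a 0%N w)%:E)%E) => k; rewrite Ea fineK// ge0_fin_numE.
    by rewrite unlock in hL2.
  by apply: integral_ge0 => w _; rewrite lee_fin.
have [m am] := Em.
have cvgP : cvg_in_probability P (scaled_ratio a r) r^-1.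
  exact: (scaled_ratio_cvg P a r ma a0 hr m am aP aP0).
split.
  rewrite (_ : (fun n w => _) = scaled_ratio a r)//.
  by apply/funext => n; apply/funext => w.
have := cvg_in_probability_expectation P (scaled_ratio a r) r^-1
  (measurable_scaled_ratio a r ma a0 hr) (scaled_ratio_ge0_le a r a0 hr) cvgP.
(* The two sequences of expectations agree for [n > 0], where the factor [n] cancels. *)
apply: cvg_trans; apply: near_eq_cvg; near=> n.
have n0 : n%:R != 0 :> R by rewrite pnatr_eq0 -lt0n; near: n; exact: nbhs_infty_gt.
have dE w : deriv_ratio r (random_poly A n w) = n%:R * scaled_ratio a r n w.
  by rewrite -fE mulVKf.
rewrite unlock; under [in RHS]eq_integral do rewrite dE EFinM.
rewrite ge0_integralZl_EFin//; last 2 first.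
- by move=> w _; rewrite lee_fin; case/andP: (scaled_ratio_ge0_le a r a0 hr n w).
- by apply/measurable_EFinP; exact: measurable_scaled_ratio.
by rewrite muleA -EFinM mulVf// mul1e.
Unshelve. all: by end_near. Qed.
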